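(* Let $d\ge 1$, let $K_1,K_2\subset\mathbb{R}^d$ be compact, let $X:=C(K_1)$ and $Y:=C(K_2)$ with the supremum norms, and let $V\subset X$ be compact. Let $\mathcal{O}:=\{G:V\to Y \text{ continuous}\}$ with norm $\|G\|_{\mathcal{O}}:=\sup_{u\in V}\|G(u)\|_Y$, and let $\mathcal{K}\subset\mathcal{O}$ be compact. Then for every $\varepsilon>0$ and every $C>1$ there exist integers $N,M\ge 1$, a number $\delta>0$, finite sets of points $\mathbf{x}=\{x_1,\dots,x_k\}\subset K_1$ and $\mathbf{y}=\{y_1,\dots,y_n\}\subset K_2$, and continuous functions $\Psi:\mathbb{R}^d\to\mathbb{R}^M$, $\rho:\mathbb{R}^{k+N}\to\mathbb{R}^M$ and $\Phi:\mathbb{R}^{k+n}\to\mathbb{R}^N$, such that $$\sup_{G\in\mathcal{K}}\left|\,G(u_q)(y)-\Psi(y)\cdot\rho\!\left(u_q(\mathbf{x}),\ \frac{1}{m}\sum_{i=1}^m\Phi\big(u_i(\mathbf{x}),G(u_i)(\mathbf{y})\big)\right)\right|<\varepsilon$$ for every $(\delta,C)$-discretization $\{u_1,\dots,u_m\}$ of $V$ (with $m$ arbitrary), every $u_q\in V$, and every $y\in K_2$.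
   Context: For a continuous function $u$ on a set containing points $\mathbf{z}=\{z_1,\dots,z_r\}$, write $u(\mathbf{z}):=(u(z_1),\dots,u(z_r))\in\mathbb{R}^r$. Definition: for a compact metric space $K$, $\delta>0$ and $C>1$, a $(\delta,C)$-discretization of $K$ is a finite set of points $\{z_1,\dots,z_m\}\subset K$ such that for all $x,y\in K$, $|\{i: z_i\in B(x,\delta/2)\}|< C\,|\{i: z_i\in B(y,\delta)\}|$, where $B(p,r)$ denotes the open ball of radius $r$ centered at $p$. Here $V$ is regarded as a compact metric space with the metric of $C(K_1)$ (supremum norm). The dot denotes the Euclidean inner product in $\mathbb{R}^M$. *)

(* Defs.v *)
From mathcomp Require Import all_boot all_order all_algebra.
From mathcomp Require Import all_classical all_reals all_analysis.
Import Order.TTheory GRing.Theory Num.Theory.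
Import numFieldNormedType.Exports.
Local Open Scope classical_set_scope.
Local Open Scope ring_scope.

Definition supdist {R : realType} {T : Type} (K : set T) (f g : T -> R) : R :=
  sup [set `|f x - g x| | x in K].

Definition discretization {R : realType} {T : Type} (K : set T)
  (V : set (T -> R)) (delta C : R) {m : nat} (z : 'I_m -> (T -> R)) : Prop :=
  (forall i, V (z i)) /\
  (forall x y, V x -> V y ->
     (#|[set i : 'I_m | `[< supdist K (z i) x < delta / 2 >] ]|%:R : R)
       < C * (#|[set i : 'I_m | `[< supdist K (z i) y < delta >] ]|%:R)).

(* Main.v *)
(** Cover [V] by finitely many balls around [p_1, ..., p_L], so small that every
    [G] in the compact family varies little on each of them, and let [b_l] be a
    tent function supported near [p_l]. By equicontinuity of [V], [b_l(u)] can be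
    computed from finitely many samples [u(xs)]. The map [Phi] records, for each
    [l], the numbers [b_l(u_i)] and [b_l(u_i) G(u_i)(y_j)]; the quotient of their
    means over [i] is a convex combination of values [G(u_i)(y_j)] with [u_i] near
    [p_l], hence close to [G(p_l)(y_j)]. The discretization property bounds the
    mean of [b_l(u_i)] away from [0], uniformly in the discretization, so that
    this quotient is a continuous function of the means. Partitions of unity
    on [V] (subordinate to the [p_l], inside [rho]) and on [K2] (the map [Psi])
    then interpolate these values to [G(u_q)(y)]. Everything being a convex
    combination, the three errors simply add up. *)
Require Import Defs.
From mathcomp Require Import all_boot all_order all_algebra.
From mathcomp Require Import all_classical all_reals all_analysis.
From mathcomp Require Import ring lra.
Import Order.TTheory GRing.Theory Num.Theory.
Import numFieldNormedType.Exports.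
Local Open Scope classical_set_scope.
Local Open Scope ring_scope.

(** * Compactness in uniform spaces: finite nets and equicontinuity *)

(** Near-covering compactness is applied to the filter of finite subsets of [A] directed by
    inclusion: near [x], every finite set containing [x] already has a member [E]-close to the
    point. *)
Lemma finite_net (T : uniformType) (A : set T) (E : set (T * T)) :
  compact A -> entourage E ->
  exists (n : nat) (p : 'I_n -> T),
    (forall i, A (p i)) /\ forall x, A x -> exists i, E (p i, x).
Proof.
move=> /compact_near_coveringP cA entE.
pose D := [set s : seq T | forall q, q \in s -> A q].
pose B (s : seq T) := [set t : seq T | D t /\ forall q, q \in s -> q \in t].
have fB : Filter (filter_from D B).
  apply: filter_from_filter; first by exists [::] => q; rewrite in_nil.
  move=> s t Ds Dt; exists (s ++ t).
    by move=> q; rewrite mem_cat => /orP[/Ds|/Dt].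
  by move=> w [Dw sw]; split; split=> // q qs; apply: sw; rewrite mem_cat qs ?orbT.
have [|s Ds Bs] := cA _ (filter_from D B)
    (fun s x => D s /\ exists2 q, q \in s & E (q, x)) fB.
  move=> x Ax; exists (xsection E x, B [:: x]) => /=.
    split; first exact: nbhs_entourage.
    by exists [:: x] => // q; rewrite inE => /eqP ->.
  move=> [x' s] /= [/xsectionP Exx' [Ds xs]]; split=> //.
  by exists x => //; apply: xs; rewrite mem_head.
exists (size s), (tnth (in_tuple s)); split=> [i|x Ax].
  by apply: Ds; exact: mem_tnth.
have [_ [q qs Eqx]] := Bs s (conj Ds (fun _ => id)) x Ax.
have /tnthP[i qi] : q \in in_tuple s by [].
by exists i; rewrite -qi.
Qed.

(* The near-covering form of compactness is used with the entourage filter as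
   parameter; the dummy equation [x = xy.1] lets the point of [K] being covered
   play the role of the first component of the pair. *)
Lemma compact_unif_continuous (T U : uniformType) (K : set T) (f : T -> U)
    (E : set (U * U)) :
  compact K -> {within K, continuous f} -> entourage E ->
  \forall xy \near entourage, K xy.1 -> K xy.2 -> E (f xy.1, f xy.2).
Proof.
move=> /compact_near_coveringP cK cf entE.
pose P (xy : T * T) x := x = xy.1 -> K xy.1 -> K xy.2 -> E (f xy.1, f xy.2).
have : \forall xy \near entourage, K `<=` P xy.
  apply: (cK _ entourage P) => x Kx.
  have fx : nbhs x (fun y => K y -> split_ent E (f x, f y)).
    have /subspace_continuousP/(_ x Kx) := cf.
    move=> /(_ _ (nbhs_entourage (f x) (entourage_split_ent entE))).
    by apply: (@filterS _ (nbhs x)) => y + Ky => /(_ Ky)/xsectionP.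
  have fx' : nbhs x (fun y => K y -> split_ent E (f y, f x)).
    have /subspace_continuousP/(_ x Kx) := cf.
    move=> /(_ _ (nbhs_entourage (f x) (entourage_inv (entourage_split_ent entE)))).
    by apply: (@filterS _ (nbhs x)) => y + Ky => /(_ Ky)/xsectionP.
  have [D entD Dx] := (nbhsP _ _).1 fx.
  exists (xsection (split_ent D) x `&` [set y | K y -> split_ent E (f y, f x)],
          split_ent D) => /=.
    split; last exact: entourage_split_ent.
    by apply: filterI => //; exact/nbhs_entourage/entourage_split_ent.
  move=> [x' [a b]] /= [[/xsectionP Dxx' Efx] Dab] x'a Ka Kb; subst x'.
  apply: (entourage_split (f x)) => //; first exact: Efx.
  by apply: Dx => //; apply/xsectionP; exact: (entourage_split a).
by apply: filterS => xy KP Kx Ky; exact: (KP xy.1).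
Qed.

(** Every [g] uniformly near [f] on [K] inherits the uniform continuity of [f] through the chain
    [g a], [f a], [f b], [g b]; compactness of [F] then gives one entourage for all [f]. *)
Lemma compact_unif_equicontinuous (T U : uniformType) (K : set T)
    (F : set {uniform` K -> U}) (E : set (U * U)) :
  compact K -> (forall f, F f -> {within K, continuous (f : T -> U)}) ->
  compact F -> entourage E ->
  \forall xy \near entourage, forall f, F f -> K xy.1 -> K xy.2 ->
    E (f xy.1, f xy.2).
Proof.
move=> cK Fc /compact_near_coveringP cF entE.
pose P (xy : T * T) f := F f -> K xy.1 -> K xy.2 -> E (f xy.1, f xy.2).
have : \forall xy \near entourage, F `<=` P xy.
  apply: (cF _ entourage P) => f Ff.
  have entE1 := entourage_split_ent entE.
  have entE2 := entourage_split_ent entE1.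
  pose N := split_ent (split_ent E).
  exists ([set g | forall x, K x -> (N `&` N^-1%relation) (f x, g x)],
    [set xy | K xy.1 -> K xy.2 -> N (f xy.1, f xy.2)]) => /=.
    split; last by apply: compact_unif_continuous => //; exact: Fc.
    apply/uniform_nbhs; exists (N `&` N^-1%relation); split => //.
    by apply: filterI => //; exact: entourage_inv.
  move=> [g [a b]] /= [fg fab] Fg Ka Kb.
  apply: (entourage_split (f b)) => //; last first.
    (* The chain has three links but two splits allow four, so the last link is padded by a trivial
       one. *)
    by apply: subset_split_ent => //; exists (f b); [exact: entourage_refl|exact: (fg b Kb).1].
  by apply: (entourage_split (f a)) => //; [exact: (fg a Ka).2|exact: fab].
by apply: filterS => xy FP f Ff; exact: FP.
Qed.

Lemma continuous_uniform_eval (T U : uniformType) (K : set T) (x : T) :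
  K x -> continuous (fun f : {uniform` K -> U} => f x).
Proof.
move=> Kx f A /nbhsP[E entE EA]; rewrite nbhs_simpl/=; apply/uniform_nbhs.
by exists E; split=> // g fg; apply: EA; apply/xsectionP; exact: fg.
Qed.

(** For fixed [u] the values [f u] form a compact set, the image of [F] under evaluation, hence are
    equicontinuous on [K]. Equicontinuity of [F] on [V] carries this to all [v] near [u], and
    compactness of [V] finishes. *)
Lemma compact_values_equicontinuous (T S U : uniformType) (V : set T)
    (K : set S) (F : set {uniform` V -> {uniform` K -> U}}) (E : set (U * U)) :
  compact V -> compact K ->
  (forall f, F f ->
     {within V, continuous (f : T -> {uniform` K -> U})} /\
     (forall u, V u -> {within K, continuous (f u : S -> U)})) ->
  compact F -> entourage E ->
  \forall xy \near entourage, forall f u, F f -> V u -> K xy.1 -> K xy.2 ->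
    E (f u xy.1, f u xy.2).
Proof.
move=> cV cK Fc cF entE.
pose P (xy : S * S) u := V u -> forall f, F f -> K xy.1 -> K xy.2 ->
  E (f u xy.1, f u xy.2).
have : \forall xy \near entourage, V `<=` P xy.
  have /compact_near_coveringP cV' := cV.
  apply: (cV' _ entourage P) => u Vu.
  have entE1 := entourage_split_ent entE.
  have entE2 := entourage_split_ent entE1.
  pose N := split_ent (split_ent E).
  pose M : set ({uniform` K -> U} * {uniform` K -> U}) :=
    [set gh | forall y, K y -> (N `&` N^-1%relation) (gh.1 y, gh.2 y)].
  have entM : entourage M.
    rewrite uniform_entourage; exists (N `&` N^-1%relation) => //.
    by apply: filterI => //; exact: entourage_inv.
  have equiF := @compact_unif_equicontinuous _ _ _ _ _ cV (fun f Ff => (Fc f Ff).1) cF entM.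
  have equiu : \forall xy \near entourage, forall g, ((fun f : {uniform` V -> {uniform` K -> U}} => f u) @` F) g ->
      K xy.1 -> K xy.2 -> N (g xy.1, g xy.2).
    apply: compact_unif_equicontinuous => //.
      by move=> _ [f Ff <-]; exact: (Fc f Ff).2.
    apply: continuous_compact => //; apply: continuous_subspaceT.
    exact: continuous_uniform_eval.
  exists (xsection [set xy | forall f, F f -> V xy.1 -> V xy.2 ->
      M (f xy.1, f xy.2)] u,
    [set xy | forall g, ((fun f : {uniform` V -> {uniform` K -> U}} => f u) @` F) g ->
      K xy.1 -> K xy.2 -> N (g xy.1, g xy.2)]) => /=.
    by split => //; exact: nbhs_entourage.
  move=> [v [a b]] /= [/xsectionP Muv Nab] Vv f Ff Ka Kb.
  have Mf := Muv f Ff Vu Vv.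
  apply: (entourage_split (f u b)) => //; last first.
    by apply: subset_split_ent => //; exists (f u b); [exact: entourage_refl|exact: (Mf b Kb).1].
  apply: (entourage_split (f u a)) => //; first exact: (Mf a Ka).2.
  by apply: Nab => //; exists f.
by apply: filterS => xy VP f u Ff Vu; exact: VP.
Qed.

(** * Tent functions, partitions of unity and weighted means *)

(** The support radius is twice the net radius [eta], so that within [eta] of the centre the value
    is still at least [eta]. *)
Definition tent {R : realType} {W : normedModType R} (eta : R) (q v : W) : R :=
  Num.max 0 (2 * eta - `|v - q|).

(* The maximum with [eta] makes this continuous everywhere; it is inactive, and
   the functions sum to [1], at distance at most [eta] from the centres. *)
Definition pou {R : realType} {W : normedModType R} {L : nat} (eta : R) (q : 'I_L -> W)
    (l : 'I_L) (v : W) : R :=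
  tent eta (q l) v / Num.max eta (\sum_(i < L) tent eta (q i) v).

Lemma tent_ge0 (R : realType) (W : normedModType R) (eta : R) (q v : W) : 0 <= tent eta q v.
Proof. by rewrite le_max lexx. Qed.

Lemma tent_neq0 (R : realType) (W : normedModType R) (eta : R) (q v : W) :
  tent eta q v != 0 -> `|v - q| < 2 * eta.
Proof.
rewrite /tent -subr_gt0; case: (leP (2 * eta - `|v - q|) 0) => //.
by rewrite eqxx.
Qed.

Lemma tent_ge (R : realType) (W : normedModType R) (eta : R) (q v : W) :
  `|v - q| <= eta -> eta <= tent eta q v.
Proof. by move=> h; rewrite le_max; apply/orP; right; lra. Qed.

Lemma continuous_tent (R : realType) (W : normedModType R) (eta : R) (q : W) :
  continuous (tent eta q).
Proof.
move=> v; apply: (@continuous_max R W (cst 0)); first exact: cvg_cst.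
apply: continuousB; first exact: cvg_cst.
by apply: cvg_norm; apply: cvgB => //; exact: cvg_cst.
Qed.

Lemma continuous_sumr (R : realType) (W : topologicalType) (L : nat) (f : 'I_L -> W -> R) :
  (forall i, continuous (f i)) -> continuous (fun v => \sum_(i < L) f i v).
Proof.
by move=> fc; apply: continuous_big => //; exact: add_continuous.
Qed.

Lemma continuous_mulr (R : realType) (W : topologicalType) (f g : W -> R) :
  continuous f -> continuous g -> continuous (fun v => f v * g v).
Proof. by move=> fc gc v; apply: cvgM; [exact: fc|exact: gc]. Qed.

Lemma continuous_div_max (R : realType) (W : topologicalType) (f g : W -> R) (c : R) :
  0 < c -> continuous f -> continuous g ->
  continuous (fun v => f v / Num.max c (g v)).
Proof.
move=> c0 fc gc v; apply: cvgM; first exact: fc.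
apply: cvgV; first by rewrite gt_eqF// lt_max c0.
by apply: (@continuous_max R W (cst c)); [exact: cvg_cst|exact: gc].
Qed.

Lemma continuous_mx (R : realType) (W : topologicalType) (m n : nat) (f : W -> 'M[R]_(m, n)) :
  (forall i j, continuous (fun v => f v i j)) -> continuous f.
Proof.
move=> fc v; apply/cvgrPdist_le => /= e e0; near=> x.
rewrite /Num.Def.normr/= mx_normrE (bigmax_le _ (ltW e0))//= => i _.
rewrite !mxE/=; move: i; near: x; apply: filter_forall => /= i.
by move: e e0; apply/cvgrPdist_le; exact: fc.
Unshelve. all: by end_near. Qed.
Lemma pou_neq0 (R : realType) (W : normedModType R) (L : nat) (eta : R)
    (q : 'I_L -> W) (l : 'I_L) (v : W) :
  pou eta q l v != 0 -> `|v - q l| < 2 * eta.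
Proof. by rewrite mulf_eq0 negb_or => /andP[/tent_neq0]. Qed.

Lemma pou_ge0 (R : realType) (W : normedModType R) (L : nat) (eta : R)
    (q : 'I_L -> W) (l : 'I_L) (v : W) :
  0 < eta -> 0 <= pou eta q l v.
Proof. by move=> e0; rewrite divr_ge0 ?tent_ge0// le_max ltW. Qed.

Lemma sum_pou (R : realType) (W : normedModType R) (L : nat) (eta : R)
    (q : 'I_L -> W) (v : W) :
  0 < eta -> (exists l, `|v - q l| <= eta) -> \sum_(l < L) pou eta q l v = 1.
Proof.
move=> e0 [l vl]; have es : eta <= \sum_(i < L) tent eta (q i) v.
  rewrite (bigD1 l)//=; apply: (le_trans (tent_ge _ _ _ _ _ vl)).
  by rewrite lerDl sumr_ge0// => i _; exact: tent_ge0.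
rewrite /pou -mulr_suml max_r// divff// gt_eqF//.
exact: lt_le_trans es.
Qed.

Lemma continuous_pou (R : realType) (W : normedModType R) (L : nat) (eta : R)
    (q : 'I_L -> W) (l : 'I_L) :
  0 < eta -> continuous (pou eta q l).
Proof.
move=> e0; apply: continuous_div_max => //; first exact: continuous_tent.
by apply: continuous_sumr => i; exact: continuous_tent.
Qed.

(** The constant [c] is its own weighted mean. Asking for closeness only at nonzero weights lets
    supports of tents localise the estimate. *)
Lemma weighted_mean_dist (R : realType) (L : nat) (w f : 'I_L -> R) (c e : R) :
  (forall i, 0 <= w i) -> \sum_(i < L) w i = 1 ->
  (forall i, w i != 0 -> `|c - f i| <= e) -> `|c - \sum_(i < L) w i * f i| <= e.
Proof.
move=> w0 w1 wf; rewrite -[X in X - _]mul1r -w1 mulr_suml -sumrB.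
apply: (le_trans (ler_norm_sum _ _ _)).
rewrite -[leRHS]mul1r -w1 mulr_suml; apply: ler_sum => i _.
rewrite -mulrBr normrM ger0_norm//.
have [->|wi0] := eqVneq (w i) 0; first by rewrite !mul0r.
by rewrite ler_wpM2l// wf.
Qed.

(** * Row norms, supremum distance and density of discretizations *)

Lemma row_norm_ltP (R : realType) (k : nat) (v : 'rV[R]_k) (e : R) :
  0 < e -> reflect (forall i, `|v 0 i| < e) (`|v| < e).
Proof.
move=> e0; apply: (iffP idP) => [ve i|ve].
  apply: le_lt_trans ve; rewrite [leRHS]/Num.Def.normr/= mx_normrE.
  exact: (le_bigmax _ (fun ij : 'I_1 * 'I_k => `|v ij.1 ij.2|) (0, i)).
rewrite /Num.Def.normr/= mx_normrE bigmax_lt// => -[i j] _ /=.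
by rewrite ord1.
Qed.

Lemma row_norm_le (R : realType) (k : nat) (v : 'rV[R]_k) (e : R) :
  0 <= e -> (forall i, `|v 0 i| <= e) -> `|v| <= e.
Proof.
move=> e0 ve; rewrite /Num.Def.normr/= mx_normrE bigmax_le// => -[i j] _ /=.
by rewrite ord1.
Qed.

(* Bounding [m] by the [delta/2]-balls of a cover and each of these by the
   [delta]-ball around [y] shows that the latter has density at least [1/(P C)]. *)
Lemma discretization_density (R : realType) (T : Type) (K : set T)
    (V : set (T -> R)) (delta C : R) (m P : nat) (z : 'I_m -> T -> R)
    (q : 'I_P -> T -> R) (y : T -> R) :
  discretization K V delta C z -> (forall j, V (q j)) ->
  (forall u, V u -> exists j, supdist K u (q j) < delta / 2) -> V y ->
  m%:R <= P%:R * (C * #|[set i : 'I_m | `[< supdist K (z i) y < delta >]]|%:R).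
Proof.
move=> [Vz zC] Vq qV Vy.
pose B j := [set i : 'I_m | `[< supdist K (z i) (q j) < delta / 2 >]].
have mB : (m <= \sum_(j < P) #|B j|)%N.
  under eq_bigr do rewrite -sum1_card big_mkcond/=.
  rewrite exchange_big/= -[leqLHS]card_ord -sum1_card leq_sum// => i _.
  have [j ij] := qV _ (Vz i).
  by rewrite (bigD1 j)//= ifT// inE; apply/asboolP.
have /le_trans : (m%:R : R) <= (\sum_(j < P) #|B j|)%N%:R by rewrite ler_nat.
apply; rewrite natr_sum mulr_natl -[in X in _ *+ X](card_ord P) -sumr_const.
by apply: ler_sum => j _; exact/ltW/zC.
Qed.

Lemma supdist_lt (R : realType) (T : Type) (K : set T) (f g : T -> R) (e d : R) :
  0 <= e -> e < d -> (forall x, K x -> `|f x - g x| <= e) -> supdist K f g < d.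
Proof.
move=> e0 ed fg; apply: le_lt_trans ed; rewrite /supdist.
(* Over an empty [K] the supremum is [0], whence the hypothesis [0 <= e]. *)
have [->|/set0P[a Ka]] := eqVneq K set0; first by rewrite image_set0 sup0.
apply: ge_sup; first by exists `|f a - g a|; exists a.
by move=> _ [x Kx <-]; exact: fg.
Qed.

(** Continuity on a compact set bounds the differences, so their real supremum is a genuine upper
    bound. *)
Lemma le_supdist (R : realType) (T : topologicalType) (K : set T)
    (f g : T -> R) (x : T) :
  compact K -> {within K, continuous f} -> {within K, continuous g} -> K x ->
  `|f x - g x| <= supdist K f g.
Proof.
move=> cK fc gc Kx; apply: ub_le_sup; last by exists x.
have [M [_ MK]] : bounded_set ((fun x => f x - g x) @` K).
  apply: compact_bounded; apply: continuous_compact => // y.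
  by apply: cvgB; [exact: fc|exact: gc].
exists (M + 1) => _ [y Ky <-].
by apply: (MK (M + 1)); [rewrite ltrDl|exists y].
Qed.

(** * Metric nets and finite sampling of functions *)

Lemma entourage_uniformP (R : realType) (T : choiceType) (K : set T)
    (A : set ({uniform` K -> R} * {uniform` K -> R})) :
  entourage A <-> exists2 e : R, 0 < e &
    forall f g, (forall x, K x -> `|f x - g x| < e) -> A (f, g).
Proof.
rewrite uniform_entourage; split => [[E]|[e e0 eA]].
  rewrite -entourage_ballE => -[e e0 eE EA]; exists e => // f g fg.
  by apply: EA => x Kx; apply: eE; exact: fg.
exists [set xy : R * R | `|xy.1 - xy.2| < e].
  by rewrite -entourage_ballE; exists e.
by move=> [f g] /eA.
Qed.

Lemma row_compact_net (R : realType) (d : nat) (K : set 'rV[R]_d) (e : R) :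
  compact K -> 0 < e -> exists (n : nat) (p : 'I_n -> 'rV[R]_d),
    (forall i, K (p i)) /\ forall x, K x -> exists i, `|x - p i| <= e.
Proof.
move=> cK e0.
have [n [p [Kp pK]]] := finite_net _ _ _ cK (entourage_ball _ (PosNum e0)).
exists n, p; split=> // x Kx; have [i] := pK x Kx.
rewrite /= -ball_normE /= => pix; exists i.
by rewrite distrC ltW.
Qed.

Lemma uniform_compact_net (R : realType) (T : choiceType) (K : set T)
    (V : set {uniform` K -> R}) (e : R) :
  compact V -> 0 < e -> exists (n : nat) (p : 'I_n -> {uniform` K -> R}),
    (forall i, V (p i)) /\
    forall u, V u -> exists i, forall x, K x -> `|u x - p i x| < e.
Proof.
move=> cV e0.
pose A := [set fg : {uniform` K -> R} * {uniform` K -> R} |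
  forall x, K x -> `|fg.1 x - fg.2 x| < e].
have entA : entourage A by apply/entourage_uniformP; exists e.
have [n [p [Vp pV]]] := finite_net _ _ _ cV entA.
exists n, p; split=> // u Vu; have [i Ai] := pV u Vu.
by exists i => x Kx; rewrite distrC; exact: Ai.
Qed.

(** The samples form a net of [K] at the scale where all of [V] oscillates by less than [eta]; the
    errors are [eta], [2 * eta] and [eta]. *)
Lemma compact_sampling (R : realType) (d : nat) (K : set 'rV[R]_d)
    (V : set {uniform` K -> R}) (eta : R) :
  compact K -> (forall u, V u -> {within K, continuous (u : 'rV[R]_d -> R)}) ->
  compact V -> 0 < eta ->
  exists (k : nat) (xs : 'I_k -> 'rV[R]_d), (forall i, K (xs i)) /\
    forall u v, V u -> V v -> (forall i, `|u (xs i) - v (xs i)| < 2 * eta) ->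
    forall x, K x -> `|u x - v x| < 4 * eta.
Proof.
move=> cK Vc cV eta0.
have := compact_unif_equicontinuous _ _ _ _ _ cK Vc cV
  (entourage_ball R (PosNum eta0)).
move=> /(finite_net _ _ _ cK)[k [xs [Kxs net]]].
exists k, xs; split=> // u v Vu Vv uv x Kx.
have [i xix] := net x Kx.
have := xix u Vu (Kxs i) Kx; have := xix v Vv (Kxs i) Kx; have := uv i.
rewrite /= -ball_normE /= => uvi vi ui.
have -> : u x - v x = (v (xs i) - v x) - (u (xs i) - u x) + (u (xs i) - v (xs i)).
  lra.
apply: le_lt_trans (ler_normD _ _) _.
have := ler_normB (v (xs i) - v x) (u (xs i) - u x).
by move=> h; lra.
Qed.

(** * Moduli of continuity uniform over the operator family *)

Section CompactOperators.
Context (R : realType) (d : nat) (K1 K2 : set 'rV[R]_d).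
Context (V : set {uniform` K1 -> R})
  (KK : set {uniform` V -> {uniform` K2 -> R}}).
Context (cV : compact V).
Context (KKc : forall G, KK G ->
  {within V, continuous (G : {uniform` K1 -> R} -> {uniform` K2 -> R})} /\
  (forall u, V u -> {within K2, continuous (G u : 'rV[R]_d -> R)})).
Context (cKK : compact KK).

(** Compactness of [KK] gives one modulus for all operators, so nets and networks can be fixed
    before [G]. *)
Lemma operators_equicontinuous (e : R) : 0 < e ->
  exists2 r : R, 0 < r & forall G u v y, KK G -> V u -> V v -> K2 y ->
    (forall x, K1 x -> `|u x - v x| < r) -> `|G u y - G v y| <= e.
Proof.
move=> e0; pose A := [set fg : {uniform` K2 -> R} * {uniform` K2 -> R} |
  forall x, K2 x -> `|fg.1 x - fg.2 x| < e].
have entA : entourage A by apply/entourage_uniformP; exists e.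
have := compact_unif_equicontinuous _ _ _ _ _ cV (fun G KG => (KKc G KG).1) cKK entA.
move=> /entourage_uniformP[r r0 rA]; exists r => // G u v y KG Vu Vv Ky uv.
exact/ltW/(rA u v uv G KG Vu Vv y Ky).
Qed.

Lemma operator_values_equicontinuous (e : R) : compact K2 -> 0 < e ->
  exists2 s : R, 0 < s & forall G u y y', KK G -> V u -> K2 y -> K2 y' ->
    `|y - y'| < s -> `|G u y - G u y'| <= e.
Proof.
move=> cK2 e0.
have : entourage [set yy' : 'rV[R]_d * 'rV[R]_d | forall G u, KK G -> V u ->
    K2 yy'.1 -> K2 yy'.2 -> ball (G u yy'.1 : R) e (G u yy'.2)].
  exact: (compact_values_equicontinuous _ _ _ _ _ _ _ cV cK2 KKc cKK
    (entourage_ball R (PosNum e0))).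
rewrite -entourage_ballE => -[s s0 sE].
exists s => // G u y y' KG Vu Ky Ky' yy'; apply/ltW.
have := sE (y, y'); rewrite /= -!ball_normE /=.
by move=> /(_ yy' G u KG Vu Ky Ky').
Qed.

End CompactOperators.

(** * Reconstruction from means, encoder and decoder *)

(** With the maximum inactive, the factors [m%:R^-1] cancel and the quotient is a convex combination
    over [i]. The whole is thus three nested convex combinations of the [g i j]. *)
Lemma reconstruction_error (R : realType) (m L n : nat) (b : 'I_L -> 'I_m -> R)
    (g : 'I_m -> 'I_n -> R) (a : 'I_L -> R) (psi : 'I_n -> R) (c c0 e : R) :
  (forall l, 0 <= a l) -> \sum_(l < L) a l = 1 ->
  (forall j, 0 <= psi j) -> \sum_(j < n) psi j = 1 ->
  (forall l i, 0 <= b l i) -> 0 < c0 ->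
  (forall l, c0 <= m%:R^-1 * \sum_(i < m) b l i) ->
  (forall j l i, psi j != 0 -> a l != 0 -> b l i != 0 -> `|c - g i j| <= e) ->
  `|c - \sum_(j < n) psi j * \sum_(l < L) a l *
      ((m%:R^-1 * \sum_(i < m) b l i * g i j) /
       Num.max c0 (m%:R^-1 * \sum_(i < m) b l i))| <= e.
Proof.
move=> a0 a1 psi0 psi1 b0 c00 c0b H.
apply: weighted_mean_dist => // j pj; apply: weighted_mean_dist => // l al.
have mb : m%:R^-1 * \sum_(i < m) b l i != 0.
  by rewrite gt_eqF// (lt_le_trans c00).
move: (mb); rewrite mulf_eq0 negb_or => /andP[m0 B0].
rewrite max_r// invfM mulrACA divff// mul1r mulrC mulr_sumr.
under eq_bigr do rewrite mulrA.
apply: weighted_mean_dist => [i||i].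
- by rewrite mulr_ge0// invr_ge0 sumr_ge0.
- by rewrite -mulr_sumr mulVf.
- by rewrite mulf_eq0 negb_or => /andP[_ bi]; exact: H pj al bi.
Qed.

Lemma continuous_lsubmx (R : realType) (k n : nat) :
  continuous (lsubmx : 'rV[R]_(k + n) -> 'rV[R]_k).
Proof.
apply: continuous_mx => i j.
rewrite (_ : (fun _ => _) = (fun w : 'rV[R]_(k + n) => w i (lshift n j))).
  exact: coord_continuous.
by apply/funext => w; rewrite mxE.
Qed.

Lemma continuous_rsubmx (R : realType) (k n : nat) :
  continuous (rsubmx : 'rV[R]_(k + n) -> 'rV[R]_n).
Proof.
apply: continuous_mx => i j.
rewrite (_ : (fun _ => _) = (fun w : 'rV[R]_(k + n) => w i (rshift k j))).
  exact: coord_continuous.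
by apply/funext => w; rewrite mxE.
Qed.

(* Row [l] of the encoded matrix is [b_l(u)] times [(1, G(u)(y_1), ..., G(u)(y_n))]. *)
Definition encoder {R : realType} {k n L : nat} (eta : R) (q : 'I_L -> 'rV[R]_k)
    (w : 'rV[R]_(k + n)) : 'rV[R]_(L * n.+1) :=
  mxvec (\matrix_(l, j) (tent eta (q l) (lsubmx w) *
    (if unlift ord0 j is Some j' then rsubmx w 0 j' else 1))).

(* [c0] is a lower bound for the mean of each [b_l] over a discretization, so the
   maximum is inactive on the inputs of interest. *)
Definition decoder {R : realType} {k n L : nat} (eta c0 : R)
    (q : 'I_L -> 'rV[R]_k) (w : 'rV[R]_(k + L * n.+1)) : 'rV[R]_n :=
  \row_j \sum_(l < L) pou eta q l (lsubmx w) *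
    (rsubmx w 0 (mxvec_index l (lift ord0 j)) /
     Num.max c0 (rsubmx w 0 (mxvec_index l ord0))).

Lemma continuous_encoder (R : realType) (k n L : nat) (eta : R)
    (q : 'I_L -> 'rV[R]_k) :
  continuous (encoder eta q : 'rV[R]_(k + n) -> _).
Proof.
apply: continuous_mx => i0 ij; rewrite ord1; case/mxvec_indexP: ij => l j.
rewrite (_ : (fun _ => _) = (fun w : 'rV[R]_(k + n) => tent eta (q l) (lsubmx w) *
    (if unlift ord0 j is Some j' then rsubmx w 0 j' else 1))); last first.
  by apply/funext => w; rewrite mxvecE mxE.
apply: continuous_mulr.
  move=> w; apply: (@continuous_comp _ _ _ lsubmx (tent eta (q l))).
    exact: continuous_lsubmx.
  exact: continuous_tent.
case: (unlift ord0 j) => [j'|]; last exact: cst_continuous.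
move=> w; apply: (@continuous_comp _ _ _ rsubmx (fun u : 'rV[R]_n => u 0 j')).
  exact: continuous_rsubmx.
exact: coord_continuous.
Qed.

Lemma continuous_decoder (R : realType) (k n L : nat) (eta c0 : R)
    (q : 'I_L -> 'rV[R]_k) :
  0 < eta -> 0 < c0 ->
  continuous (decoder eta c0 q : 'rV[R]_(k + L * n.+1) -> _).
Proof.
move=> e0 c00; apply: continuous_mx => i j; rewrite ord1.
rewrite (_ : (fun _ => _) = (fun w => \sum_(l < L) pou eta q l (lsubmx w) *
    (rsubmx w 0 (mxvec_index l (lift ord0 j)) /
     Num.max c0 (rsubmx w 0 (mxvec_index l ord0))))); last first.
  by apply/funext => w; rewrite mxE.
apply: continuous_sumr => l; apply: continuous_mulr.
  move=> w; apply: (@continuous_comp _ _ _ lsubmx (pou eta q l)).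
    exact: continuous_lsubmx.
  exact: continuous_pou.
have rc a : continuous (fun w : 'rV[R]_(k + L * n.+1) => rsubmx w 0 a).
  move=> v; apply: (@continuous_comp _ _ _ rsubmx (fun u : 'rV[R]__ => u 0 a)).
    exact: continuous_rsubmx.
  exact: coord_continuous.
exact: continuous_div_max.
Qed.

(** * Choice of scales and assembly of the approximation *)

Theorem theorem1 (R : realType) (d : nat) (K1 K2 : set 'rV[R]_d)
  (V : set {uniform` K1 -> R})
  (KK : set {uniform` V -> {uniform` K2 -> R}}) (eps C : R) :
  (0 < d)%N -> compact K1 -> compact K2 ->
  (forall u, V u -> {within K1, continuous (u : 'rV[R]_d -> R)}) ->
  compact V ->
  (forall G, KK G ->
     {within V, continuous (G : {uniform` K1 -> R} -> {uniform` K2 -> R})} /\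
     (forall u, V u -> {within K2, continuous (G u : 'rV[R]_d -> R)})) ->
  compact KK ->
  0 < eps -> 1 < C ->
  exists (N M : nat) (delta : R) (k n : nat)
    (xs : 'I_k -> 'rV[R]_d) (ys : 'I_n -> 'rV[R]_d)
    (Psi : 'rV[R]_d -> 'rV[R]_M) (rho : 'rV[R]_(k + N) -> 'rV[R]_M)
    (Phi : 'rV[R]_(k + n) -> 'rV[R]_N),
    [/\ [/\ (0 < N)%N, (0 < M)%N & 0 < delta],
        (forall i, K1 (xs i)) /\ (forall j, K2 (ys j)),
        [/\ continuous Psi, continuous rho & continuous Phi] &
        forall (m : nat) (z : 'I_m -> {uniform` K1 -> R}),
          discretization K1 V delta C z ->
          forall (uq : {uniform` K1 -> R}) (y : 'rV[R]_d), V uq -> K2 y ->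
          (ereal_sup
             [set (`| G uq y -
                 \sum_(j < M) Psi y 0 j *
                   rho (row_mx (\row_(l < k) uq (xs l))
                          (m%:R^-1 *: \sum_(i < m)
                             Phi (row_mx (\row_(l < k) z i (xs l))
                                         (\row_(l < n) G (z i) (ys l))))) 0 j |)%:E
             | G in KK] < eps%:E)%E].
Proof.
move=> d0 cK1 cK2 Vc cV KKc cKK eps0 C1.
(* If [V] or [K2] is empty the bound is vacuous and zero maps serve. Otherwise the nets below are
   nonempty, making [N] and [M] positive. *)
have [nVK|[u0 Vu0 [y0 Ky0]]] : (forall u y, V u -> K2 y -> False) \/
    exists2 u, V u & exists y, K2 y.
  have [[u Vu]|nV] := pselect (exists u, V u); last first.
    by left=> u y Vu _; apply: nV; exists u.
  have [Ky|nK] := pselect (exists y, K2 y); first by right; exists u.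
  by left=> ? y _ Ky; apply: nK; exists y.
  exists 1%N, 1%N, 1, 0%N, 0%N, (fun=> 0), (fun=> 0), (fun=> 0), (fun=> 0), (fun=> 0).
  split=> //; first by split; case.
  - by split; exact: cst_continuous.
  - by move=> m z _ uq y /nVK/[apply].
(* Three errors of [eps / 4] leave a margin, since a supremum preserves only weak bounds. *)
have e4 : 0 < eps / 4 by rewrite divr_gt0.
have [r r0 opE] := operators_equicontinuous _ _ _ _ _ _ cV KKc cKK _ e4.
have [s s0 valE] := operator_values_equicontinuous _ _ _ _ _ _ cV KKc cKK _ cK2 e4.
(* Samples within [2 * eta] force functions within [4 * eta = r]. *)
pose eta := r / 4; have eta0 : 0 < eta by rewrite divr_gt0.
(* Tents of parameter [s / 2] vanish beyond distance [s]. *)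
have s20 : 0 < s / 2 by rewrite divr_gt0.
have [n [ys [Kys ysK]]] := row_compact_net _ _ _ _ cK2 s20.
have [k [xs [Kxs xsK]]] := compact_sampling _ _ _ _ _ cK1 Vc cV eta0.
have [L [p [Vp pV]]] := uniform_compact_net _ _ _ _ _ cV eta0.
(* A finer net [q] serves only to count: with [delta = eta], its radius lies strictly below
   [delta / 2]. *)
have eta40 : 0 < eta / 4 by rewrite divr_gt0.
have [P [q [Vq qV]]] := uniform_compact_net _ _ _ _ _ cV eta40.
have n0 : (0 < n)%N by have [j _] := ysK _ Ky0; exact: leq_ltn_trans (ltn_ord j).
have L0 : (0 < L)%N by have [j _] := pV _ Vu0; exact: leq_ltn_trans (ltn_ord j).
have P0 : (0 < P)%N by have [j _] := qV _ Vu0; exact: leq_ltn_trans (ltn_ord j).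
have C0 : 0 < C by exact: lt_trans C1.
have PC0 : 0 < P%:R * C by rewrite mulr_gt0// ltr0n.
pose S (u : 'rV[R]_d -> R) : 'rV[R]_k := \row_(l < k) u (xs l).
pose Q l := S (p l).
pose c0 := eta / (P%:R * C); have c00 : 0 < c0 by rewrite divr_gt0.
exists (L * n.+1)%N, n, eta, k, n, xs, ys, (fun y => \row_j pou (s / 2) ys j y),
  (decoder eta c0 Q), (encoder eta Q).
split=> //; first by rewrite muln_gt0 L0.
  split; [|exact: continuous_decoder|exact: continuous_encoder].
  apply: continuous_mx => i j.
  rewrite (_ : (fun _ => _) = pou (s / 2) ys j); first exact: continuous_pou.
  by apply/funext => y; rewrite mxE.
move=> m z zV uq y Vuq Ky; have [Vz zC] := zV.
have SE u v i : (S u - S v) 0 i = u (xs i) - v (xs i) by rewrite !mxE.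
have S_close u v : V u -> V v -> `|S u - S v| < 2 * eta ->
    forall x, K1 x -> `|u x - v x| < r.
  move=> Vu Vv /row_norm_ltP uv x Kx.
  have -> : r = 4 * eta by rewrite /eta; field.
  apply: xsK => // i; rewrite -SE; apply: uv.
  by rewrite mulr_gt0.
(* At least a fraction [1 / (P * C)] of the [z i] lies within [eta] of [p l], and each of these
   contributes at least [eta]. *)
have density l : c0 <= m%:R^-1 * \sum_(i < m) tent eta (Q l) (S (z i)).
  pose N := #|[set i : 'I_m | `[< supdist K1 (z i) (p l) < eta >]]|.
  have mN : m%:R <= P%:R * (C * N%:R).
    apply: (discretization_density _ _ _ _ _ _ _ _ _ q _ zV Vq _ (Vp l)).
    move=> u Vu; have [j uj] := qV _ Vu; exists j.
    apply: (@supdist_lt _ _ _ _ _ (eta / 4)); [exact: ltW|lra|].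
    by move=> x Kx; exact/ltW/uj.
  (* The strict inequality in the discretization property excludes an empty ball, hence also
     [m = 0]. *)
  have N0 : (0 : R) < N%:R.
    by have := zC _ _ (Vp l) (Vp l); rewrite -(pmulr_rgt0 _ C0); exact: le_lt_trans.
  have m0 : (0 : R) < m%:R.
    apply: (lt_le_trans N0); rewrite ler_nat -[leqRHS]card_ord.
    exact: max_card.
  have NB : N%:R * eta <= \sum_(i < m) tent eta (Q l) (S (z i)).
    rewrite mulr_natl -sumr_const big_mkcond/=; apply: ler_sum => i _.
    case: ifPn => [|_]; last exact: tent_ge0.
    rewrite inE => /asboolP zp; apply: tent_ge; apply: row_norm_le => [|j].
      exact: ltW.
    rewrite SE; apply: le_trans (ltW zp).
    by apply: le_supdist => //; [exact: Vc|exact: Vc].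
  rewrite ler_pdivlMl//; apply: le_trans NB.
  have -> : m%:R * c0 = m%:R * eta / (P%:R * C) by rewrite /c0 mulrA.
  by rewrite ler_pdivrMr//; have := ler_wpM2r (ltW eta0) mN; lra.
apply: (@le_lt_trans _ _ (3 * (eps / 4))%:E); last by rewrite lte_fin; lra.
apply: ge_ereal_sup => _ [G KG <-]; rewrite lee_fin.
have entry l j : rsubmx (row_mx (S uq) (m%:R^-1 *: \sum_(i < m)
      encoder eta Q (row_mx (S (z i)) (\row_(l < n) G (z i) (ys l)))))
      0 (mxvec_index l j) = m%:R^-1 * \sum_(i < m) tent eta (Q l) (S (z i)) *
        (if unlift ord0 j is Some j' then G (z i) (ys j') else 1).
  rewrite row_mxKr mxE summxE; congr (_ * _); apply: eq_bigr => i _.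
  rewrite mxvecE mxE row_mxKl row_mxKr; congr (_ * _).
  by case: (unlift ord0 j) => // j'; rewrite mxE.
under eq_bigr do rewrite !mxE.
under eq_bigr do under eq_bigr do rewrite !entry row_mxKl liftK unlift_none.
under eq_bigr do under eq_bigr do under [X in Num.max _ (_ * X)]eq_bigr do rewrite mulr1.
apply: (reconstruction_error _ _ _ _ _ (fun i j => G (z i) (ys j))
  (fun l => pou eta Q l (S uq)) (fun j => pou (s / 2) ys j y)) => //.
- by move=> l; exact: pou_ge0.
- apply: sum_pou => //; have [l ul] := pV _ Vuq; exists l.
  apply: row_norm_le => [|i]; first exact: ltW.
  by rewrite SE; exact/ltW/ul.
- by move=> j; exact: pou_ge0.
- by apply: sum_pou => //; exact: ysK.
- by move=> l i; exact: tent_ge0.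
(* Nonzero weights place [y] near [ys j], and both [uq] and [z i] within [r] of [p l]; the path goes
   through [G uq (ys j)] and [G (p l) (ys j)]. *)
move=> j l i /pou_neq0 yj /pou_neq0 uql /tent_neq0 zil.
have h1 : `|G uq y - G uq (ys j)| <= eps / 4.
  by apply: valE => //; lra.
have h2 : `|G uq (ys j) - G (p l) (ys j)| <= eps / 4.
  by apply: opE => //; exact: S_close.
have h3 : `|G (z i) (ys j) - G (p l) (ys j)| <= eps / 4.
  by apply: opE => //; exact: S_close.
have -> : G uq y - G (z i) (ys j) = (G uq y - G uq (ys j)) +
    (G uq (ys j) - G (p l) (ys j)) - (G (z i) (ys j) - G (p l) (ys j)) by lra.
apply: le_trans (ler_normB _ _) _.
by apply: le_trans (lerD (ler_normD _ _) (lexx _)) _; lra.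
Qed.
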